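(* For all binary relations $R$ and $S$ on IMP states and all IMP commands $c$ and $c'$: if $\vdash \langle R\rangle\ c,\ c'\ \langle S\rangle$ is derivable in the proof system described in the context, then $\vDash \langle R\rangle\ c,\ c'\ \langle S\rangle$ holds, i.e. for all states $t,t'$ with $S(t,t')$ there exist states $s,s'$ with $R(s,s')$, $(c,s)\Rightarrow t$ and $(c',s')\Rightarrow t'$.
   Context: IMP commands: $c ::= x := e \mid c;c \mid \mathbf{if}\ b\ \mathbf{then}\ c\ \mathbf{else}\ c \mid \mathbf{while}\ b\ \mathbf{do}\ c \mid \mathbf{skip}$, where $x$ ranges over program variables, $e$ over integer arithmetic expressions and $b$ over boolean expressions. A state $s$ maps variables to integers; $[e]_s$, $[b]_s$ denote evaluation in $s$, and $s(x:=v)$ is $s$ updated at $x$. $(c,s)\Rightarrow t$ is the standard big-step semantics: $(\mathbf{skip},s)\Rightarrow s$; $(x:=e,s)\Rightarrow s(x:=[e]_s)$; $(c_1;c_2,s)\Rightarrow u$ if $(c_1,s)\Rightarrow t$ and $(c_2,t)\Rightarrow u$; $\mathbf{if}\ b\ \mathbf{then}\ c_1\ \mathbf{else}\ c_2$ from $s$ runs $c_1$ if $[b]_s$ is true and $c_2$ otherwise; $(\mathbf{while}\ b\ \mathbf{do}\ c,s)\Rightarrow s$ if $[b]_s$ is false; if $[b]_s$ is true, $(c,s)\Rightarrow t$ and $(\mathbf{while}\ b\ \mathbf{do}\ c,t)\Rightarrow u$ then $(\mathbf{while}\ b\ \mathbf{do}\ c,s)\Rightarrow u$. Relations are binary relations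 on states. Under-approximate relational validity: $\vDash \langle R\rangle\ c,\ c'\ \langle S\rangle$ iff $\forall t\,t'.\ S(t,t') \implies \exists s\,s'.\ R(s,s')\land (c,s)\Rightarrow t\land (c',s')\Rightarrow t'$. Notation: $R\land S$, $R\lor S$ are pointwise on pairs; $b^1 \equiv \lambda s\,s'.\,[b]_s$; for a family $R(n)$, $n\in\mathbb{N}$, $\exists n.R(n)\equiv\lambda s\,s'.\,\exists n.\,R(n)(s,s')$; $R\implies S$ means $R\subseteq S$; $\overleftrightarrow{R}\equiv\lambda s\,s'.\,R(s',s)$; $R[x:=e]\equiv \lambda s\,s'.\ \exists v.\ R(s(x:=v),s')\land s(x)=[e]_{s(x:=v)}$. The judgement $\vdash\langle R\rangle\ c,\ c'\ \langle S\rangle$ is inductively defined by the rules: (Skip) if $\forall t\,t'.\ S(t,t')\implies\exists s'.\ R(t,s')\land (c',s')\Rightarrow t'$ then $\vdash\langle R\rangle\ \mathbf{skip},\ c'\ \langle S\rangle$; (Seq1) from $\vdash\langle R\rangle\ c,\ c'\ \langle S\rangle$ and $\vdash\langle S\rangle\ d,\ \mathbf{skip}\ \langle T\rangle$ infer $\vdash\langle R\rangle\ (c;d),\ c'\ \langle T\rangle$; (Assign) from $\vdash\langle R[x:=e]\rangle\ \mathbf{skip},\ c'\ \langle S\rangle$ infer $\vdash\langle R\rangle\ x:=e,\ c'\ \langle S\rangle$; (IfTrue) from $\vdash\langle R\land b^1\rangle\ c_1,\ c'\ \langle S\rangle$ infer $\vdash\langle R\rangle\ \mathbf{if}\ b\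 \mathbf{then}\ c_1\ \mathbf{else}\ c_2,\ c'\ \langle S\rangle$; (IfFalse) from $\vdash\langle R\land (\lnot b)^1\rangle\ c_2,\ c'\ \langle S\rangle$ infer the same conclusion; (WhileFalse) from $\vdash\langle R\land(\lnot b)^1\rangle\ \mathbf{skip},\ c'\ \langle S\rangle$ infer $\vdash\langle R\rangle\ \mathbf{while}\ b\ \mathbf{do}\ c,\ c'\ \langle S\rangle$; (WhileTrue) from $\vdash\langle R\land b^1\rangle\ (c;\mathbf{while}\ b\ \mathbf{do}\ c),\ c'\ \langle S\rangle$ infer $\vdash\langle R\rangle\ \mathbf{while}\ b\ \mathbf{do}\ c,\ c'\ \langle S\rangle$; (Back-Var) from $\forall n.\ \vdash\langle R(n)\land b^1\rangle\ c,\ \mathbf{skip}\ \langle R(n+1)\rangle$ and $\vdash\langle \exists n.R(n)\rangle\ \mathbf{while}\ b\ \mathbf{do}\ c,\ c'\ \langle S\rangle$ infer $\vdash\langle R(0)\rangle\ \mathbf{while}\ b\ \mathbf{do}\ c,\ c'\ \langle S\rangle$; (Conseq) from $R_1\implies R_2$, $\vdash\langle R_1\rangle\ c,\ c'\ \langle S_1\rangle$ and $S_2\implies S_1$ infer $\vdash\langle R_2\rangle\ c,\ c'\ \langle S_2\rangle$; (Disj) from $\vdash\langle R_1\rangle\ c,\ c'\ \langle S_1\rangle$ and $\vdash\langle R_2\rangle\ c,\ c'\ \langle S_2\rangle$ infer $\vdash\langle R_1\lor R_2\rangle\ c,\ c'\ \langle S_1\lor S_2\rangle$; (Sym) from $\vdash\langle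 \overleftrightarrow{R}\rangle\ c',\ c\ \langle \overleftrightarrow{S}\rangle$ infer $\vdash\langle R\rangle\ c,\ c'\ \langle S\rangle$. *)

(* Defs.v *)
From Stdlib Require Export String ZArith Bool Relations.

Definition var := string.
Definition state := var -> Z.
Definition rel := relation state.

Definition update (s : state) (x : var) (v : Z) : state :=
  fun y => if String.eqb x y then v else s y.

Inductive aexp : Type :=
| ANum (n : Z)
| AVar (x : var)
| AOpp (a : aexp)
| AAdd (a1 a2 : aexp)
| ASub (a1 a2 : aexp)
| AMul (a1 a2 : aexp).

Inductive bexp : Type :=
| BConst (v : bool)
| BNot (b : bexp)
| BAnd (b1 b2 : bexp)
| BOr (b1 b2 : bexp)
| BEq (a1 a2 : aexp)
| BLe (a1 a2 : aexp)
| BLt (a1 a2 : aexp).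

Fixpoint aeval (e : aexp) (s : state) : Z :=
  match e with
  | ANum n => n
  | AVar x => s x
  | AOpp a => Z.opp (aeval a s)
  | AAdd a1 a2 => Z.add (aeval a1 s) (aeval a2 s)
  | ASub a1 a2 => Z.sub (aeval a1 s) (aeval a2 s)
  | AMul a1 a2 => Z.mul (aeval a1 s) (aeval a2 s)
  end.

Fixpoint beval (b : bexp) (s : state) : bool :=
  match b with
  | BConst v => v
  | BNot b => negb (beval b s)
  | BAnd b1 b2 => andb (beval b1 s) (beval b2 s)
  | BOr b1 b2 => orb (beval b1 s) (beval b2 s)
  | BEq a1 a2 => Z.eqb (aeval a1 s) (aeval a2 s)
  | BLe a1 a2 => Z.leb (aeval a1 s) (aeval a2 s)
  | BLt a1 a2 => Z.ltb (aeval a1 s) (aeval a2 s)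
  end.

Inductive com : Type :=
| CAssign (x : var) (e : aexp)
| CSeq (c1 c2 : com)
| CIf (b : bexp) (c1 c2 : com)
| CWhile (b : bexp) (c : com)
| CSkip.

Inductive bigstep : com -> state -> state -> Prop :=
| bs_skip s : bigstep CSkip s s
| bs_assign x e s : bigstep (CAssign x e) s (update s x (aeval e s))
| bs_seq c1 c2 s t u :
    bigstep c1 s t -> bigstep c2 t u -> bigstep (CSeq c1 c2) s u
| bs_if_true b c1 c2 s t :
    beval b s = true -> bigstep c1 s t -> bigstep (CIf b c1 c2) s t
| bs_if_false b c1 c2 s t :
    beval b s = false -> bigstep c2 s t -> bigstep (CIf b c1 c2) s t
| bs_while_false b c s :
    beval b s = false -> bigstep (CWhile b c) s s
| bs_while_true b c s t u :
    beval b s = true -> bigstep c s t -> bigstep (CWhile b c) t u ->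
    bigstep (CWhile b c) s u.

Definition valid (R : rel) (c c' : com) (S : rel) : Prop :=
  forall t t', S t t' ->
    exists s s', R s s' /\ bigstep c s t /\ bigstep c' s' t'.

Definition rel_and (R S : rel) : rel := fun s s' => R s s' /\ S s s'.
Definition rel_ex (R : nat -> rel) : rel := fun s s' => exists n, R n s s'.
Definition lift1 (b : bexp) : rel := fun s _ => beval b s = true.

(* Strongest postcondition of [x := e] run on the left state: [v] is the value
   of [x] before the assignment. *)
Definition rel_assign (R : rel) (x : var) (e : aexp) : rel :=
  fun s s' => exists v,
    R (update s x v) s' /\ s x = aeval e (update s x v).

Inductive derivable : rel -> com -> com -> rel -> Prop :=
| d_skip R c' S :
    (forall t t', S t t' -> exists s', R t s' /\ bigstep c' s' t') ->
    derivable R CSkip c' S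
| d_seq1 R S T c d c' :
    derivable R c c' S -> derivable S d CSkip T ->
    derivable R (CSeq c d) c' T
| d_assign R S x e c' :
    derivable (rel_assign R x e) CSkip c' S ->
    derivable R (CAssign x e) c' S
| d_if_true R S b c1 c2 c' :
    derivable (rel_and R (lift1 b)) c1 c' S ->
    derivable R (CIf b c1 c2) c' S
| d_if_false R S b c1 c2 c' :
    derivable (rel_and R (lift1 (BNot b))) c2 c' S ->
    derivable R (CIf b c1 c2) c' S
| d_while_false R S b c c' :
    derivable (rel_and R (lift1 (BNot b))) CSkip c' S ->
    derivable R (CWhile b c) c' S
| d_while_true R S b c c' :
    derivable (rel_and R (lift1 b)) (CSeq c (CWhile b c)) c' S ->
    derivable R (CWhile b c) c' S
| d_back_var (R : nat -> rel) S b c c' :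
    (forall n, derivable (rel_and (R n) (lift1 b)) c CSkip (R (n + 1))) ->
    derivable (rel_ex R) (CWhile b c) c' S ->
    derivable (R 0) (CWhile b c) c' S
| d_conseq R1 R2 S1 S2 c c' :
    inclusion state R1 R2 -> derivable R1 c c' S1 -> inclusion state S2 S1 ->
    derivable R2 c c' S2
| d_disj R1 R2 S1 S2 c c' :
    derivable R1 c c' S1 -> derivable R2 c c' S2 ->
    derivable (union state R1 R2) c c' (union state S1 S2)
| d_sym R S c c' :
    derivable (transp state R) c' c (transp state S) ->
    derivable R c c' S.

(* Main.v *)
Require Import Defs.
From Stdlib Require Import FunctionalExtensionality PeanoNat.

(** Induction on the derivation: every rule preserves validity. Validity asks for a start pair for
    each final pair, so each case extends given runs backwards. A premise with [CSkip] on the right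
    leaves the right state fixed, so left runs can be prolonged without disturbing the right one.
    The substantial rule is Back-Var, where [while_backward] unrolls the loop backwards from [R n]
    to [R 0]. *)

Lemma bigstep_skip_inv (s t : state) : bigstep CSkip s t -> s = t.
Proof. now inversion 1. Qed.

Lemma update_idem (s : state) (x : var) (v : Z) :
  update (update s x v) x (s x) = s.
Proof.
  extensionality y; unfold update.
  now destruct (String.eqb_spec x y) as [<- | _].
Qed.

Lemma valid_seq1 (R S T : rel) (c d c' : com) :
  valid R c c' S -> valid S d CSkip T -> valid R (CSeq c d) c' T.
Proof.
  intros Hc Hd u t' HT.
  destruct (Hd u t' HT) as (t & t1' & HS & Hdt & <-%bigstep_skip_inv).
  destruct (Hc t t1' HS) as (s & s' & HR & Hcs & Hc').
  exists s, s'; eauto using bigstep.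
Qed.

(** The witness [v] in [rel_assign] is the old value of [x]: restoring it in the final state gives a
    start state from which the assignment leads back. *)
Lemma valid_assign (R S : rel) (x : var) (e : aexp) (c' : com) :
  valid (rel_assign R x e) CSkip c' S -> valid R (CAssign x e) c' S.
Proof.
  intros H t t' HS.
  destruct (H t t' HS) as (t1 & s' & (v & HR & Hx) & ->%bigstep_skip_inv & Hc').
  exists (update t x v), s'; repeat split; trivial.
  (* Only the final state is rewritten, into the form of an update of the start state. *)
  rewrite <- (update_idem t x v) at 2; rewrite Hx.
  constructor.
Qed.

(** The body premise, read backwards, gives a predecessor one index lower where [b] holds;
    prepending that iteration keeps the loop's final state, and [n] such steps reach index 0. *)
Lemma while_backward (R : nat -> rel) (b : bexp) (c : com) (n : nat) :
  (forall k, valid (rel_and (R k) (lift1 b)) c CSkip (R (k + 1))) ->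
  forall s s' t, R n s s' -> bigstep (CWhile b c) s t ->
    exists s0, R 0 s0 s' /\ bigstep (CWhile b c) s0 t.
Proof.
  intros Hbody; induction n as [|n IH]; intros s s' t HR Hw; [now eauto|].
  rewrite <- Nat.add_1_r in HR.
  destruct (Hbody n s s' HR)
    as (s1 & s1' & [HR1 Hb] & Hc & <-%bigstep_skip_inv).
  apply (IH s1); [exact HR1|].
  now apply bs_while_true with s.
Qed.

Lemma valid_back_var (R : nat -> rel) (S : rel) (b : bexp) (c c' : com) :
  (forall n, valid (rel_and (R n) (lift1 b)) c CSkip (R (n + 1))) ->
  valid (rel_ex R) (CWhile b c) c' S -> valid (R 0) (CWhile b c) c' S.
Proof.
  intros Hbody H t t' HS.
  destruct (H t t' HS) as (s & s' & (n & HR) & Hw & Hc').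
  destruct (while_backward R b c n Hbody s s' t HR Hw) as (s0 & HR0 & Hw0).
  eauto.
Qed.

(** Serves the conditional and loop-unfolding rules: the premise's start pair is reused, since the
    guard turns its left run into a run of the compound command. *)
Lemma valid_mono_start (R1 R2 S : rel) (c1 c2 c' : com) :
  (forall s s' t, R1 s s' -> bigstep c1 s t -> R2 s s' /\ bigstep c2 s t) ->
  valid R1 c1 c' S -> valid R2 c2 c' S.
Proof.
  intros Himp H t t' HS.
  destruct (H t t' HS) as (s & s' & HR & Hc & Hc').
  destruct (Himp s s' t HR Hc); eauto.
Qed.

Theorem theorem1 (R S : rel) (c c' : com) :
  derivable R c c' S -> valid R c c' S.
Proof.
  induction 1 as
    [ R c' S H | R S T c d c' _ IHc _ IHd | R S x e c' _ IH
    | R S b c1 c2 c' _ IH | R S b c1 c2 c' _ IH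
    | R S b c c' _ IH | R S b c c' _ IH
    | R S b c c' _ IHbody _ IH | R1 R2 S1 S2 c c' HR _ IH HS
    | R1 R2 S1 S2 c c' _ IH1 _ IH2 | R S c c' _ IH ].
  - intros t t' HS; destruct (H t t' HS) as (s' & HR & Hc').
    eauto using bigstep.
  - now apply valid_seq1 with S.
  - now apply valid_assign.
  - revert IH; apply valid_mono_start; intros s s' t [HR Hb] Hc.
    eauto using bigstep.
  - revert IH; apply valid_mono_start; intros s s' t [HR Hb%negb_true_iff] Hc.
    eauto using bigstep.
  - revert IH; apply valid_mono_start.
    intros s s' t [HR Hb%negb_true_iff] <-%bigstep_skip_inv.
    eauto using bigstep.
  - revert IH; apply valid_mono_start; intros s s' t [HR Hb] Hc.
    (* The sequence splits into one body run and a remaining loop run, as [bs_while_true]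
       requires. *)
    inversion Hc; subst; eauto using bigstep.
  - now apply valid_back_var.
  - intros t t' HS2; destruct (IH t t' (HS t t' HS2)) as (s & s' & HR1 & Hcs).
    exists s, s'; auto.
  - intros t t' [HS | HS];
      [ destruct (IH1 t t' HS) as (s & s' & HR & Hcs)
      | destruct (IH2 t t' HS) as (s & s' & HR & Hcs) ];
      exists s, s'; unfold union; auto.
  - intros t t' HS; destruct (IH t' t HS) as (s' & s & HR & Hc' & Hc).
    exists s, s'; auto.
Qed.
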